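(* Let $X:[0,1]\to\mathcal{H}(n)$ be a smooth curve such that $X(0)=0$ and $D=X(1)=\mathrm{diag}(d_1,\dots,d_n)$ is a diagonal matrix whose diagonal entries $d_j$ are arranged in decreasing order. Let $e_1,\dots,e_n$ be the canonical basis of $\mathbb{C}^n$, and let $\mathcal S_1=\mathrm{span}\{e_j: d_j>0\}$, $\mathcal S_2=\mathrm{span}\{e_j:d_j=0\}$ and $\mathcal S_3=\mathrm{span}\{e_j:d_j<0\}$. Then $X$ is a minimal curve joining $0$ with $D$ with respect to the trace norm if and only if, with respect to $\mathbb{C}^n=\mathcal S_1\oplus\mathcal S_2\oplus\mathcal S_3$, $$X(t)=\begin{pmatrix}P(t)&0&0\\0&0&0\\0&0&N(t)\end{pmatrix}\qquad\text{for all } t\in[0,1],$$ where $P:[0,1]\to\mathcal{H}(\mathcal S_1)$ is a minimal curve for the trace norm joining $0_{\mathcal S_1}$ with $D_{\mathcal S_1}=D|_{\mathcal S_1}$ such that $\dot P(t)\ge0$ for all $t\in[0,1]$, and $N:[0,1]\to\mathcal{H}(\mathcal S_3)$ is a minimal curve for the trace norm joining $0_{\mathcal S_3}$ with $D_{\mathcal S_3}=D|_{\mathcal S_3}$ such that $\dot N(t)\le0$ for all $t\in[0,1]$.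
   Context: $\mathcal{H}(n)$ is the real vector space of $n\times n$ complex Hermitian matrices and $\mathcal{H}(\mathcal S)$ the Hermitian operators on a subspace $\mathcal S$. The trace norm is $\|A\|_1=\mathrm{tr}\,|A|$, with $|A|=(A^*A)^{1/2}$; $\ge$ is the Löwner order. The length of a curve $X:[0,1]\to\mathcal{H}(n)$ is $L(X)=\int_0^1\|\dot X(t)\|_1dt$ (similarly in $\mathcal{H}(\mathcal S)$), and a curve is minimal if it has the least length among piecewise smooth curves with the same endpoints (equivalently, its length is the trace norm of the difference of its endpoints). *)

(* Defs.v *)
From HB Require Import structures.
From mathcomp Require Import all_boot all_order all_algebra.
From mathcomp Require Import spectral complex.
From mathcomp Require Import all_classical all_reals all_analysis.

Set Implicit Arguments.
Unset Strict Implicit.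
Unset Printing Implicit Defensive.

Import Order.TTheory GRing.Theory Num.Theory.
Import numFieldNormedType.Exports.

Local Open Scope classical_set_scope.
Local Open Scope ring_scope.
Local Open Scope complex_scope.
Local Open Scope sesquilinear_scope.

(* The square root of the positive matrix A^* A is given by functional
   calculus on a unitary diagonalisation of A^* A. *)
Definition absmx (R : realType) (n : nat) (A : 'M[R[i]]_n) : 'M[R[i]]_n :=
  let B := A ^t* *m A in
  invmx (spectralmx B) *m diag_mx (map_mx sqrtC (spectral_diag B))
    *m spectralmx B.

Definition trace_norm (R : realType) (n : nat) (A : 'M[R[i]]_n) : R :=
  complex.Re (\tr (absmx A)).

(* In R[i], 0 <= z means that z is real and nonnegative. *)
Definition loewner_le (R : realType) (n : nat) (A B : 'M[R[i]]_n) : Prop :=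
  forall v : 'cV[R[i]]_n, 0 <= (v ^t* *m (B - A) *m v) 0 0.

(* Derivatives relative to a set, so that they are one-sided at the endpoints
   when I is a closed interval; at points where f is not derivable relative to
   I, derive_on takes the default value of lim. *)
Definition diff_quot (R : realType) (f : R -> R) (t : R) : R -> R :=
  fun s => (s - t)^-1 * (f s - f t).

Definition derivable_on (R : realType) (I : set R) (f : R -> R) (t : R) : Prop :=
  cvg (diff_quot f t @ within I t^').

Definition derive_on (R : realType) (I : set R) (f : R -> R) (t : R) : R :=
  lim (diff_quot f t @ within I t^').

Definition smooth_fun_on (R : realType) (I : set R) (f : R -> R) : Prop :=
  forall (k : nat) (t : R), I t -> derivable_on I (iter k (derive_on I) f) t.

(* A curve [0,1] -> H(n) is a function on R of which only the values on [0,1]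
   matter; its regularity and velocity are those of the real and imaginary
   parts of its entries. *)
Definition smooth_on (R : realType) (n : nat) (I : set R)
    (X : R -> 'M[R[i]]_n) : Prop :=
  forall i j, smooth_fun_on I (fun t => complex.Re (X t i j)) /\
              smooth_fun_on I (fun t => complex.Im (X t i j)).

Definition velocity (R : realType) (n : nat) (X : R -> 'M[R[i]]_n) (t : R) :
    'M[R[i]]_n :=
  \matrix_(i, j) (derive_on `[0, 1] (fun s => complex.Re (X s i j)) t
               +i* derive_on `[0, 1] (fun s => complex.Im (X s i j)) t).

Definition hermitian_valued (R : realType) (n : nat) (X : R -> 'M[R[i]]_n) :
    Prop :=
  forall t : R, t \in `[0, 1] -> X t \is hermsymmx.

Definition smooth_curve (R : realType) (n : nat) (X : R -> 'M[R[i]]_n) : Prop :=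
  hermitian_valued X /\ smooth_on `[0, 1] X.

(* Consecutive closed pieces share the value of X at their common endpoint, so
   continuity on [0,1] is automatic. *)
Definition piecewise_smooth_curve (R : realType) (n : nat)
    (X : R -> 'M[R[i]]_n) : Prop :=
  hermitian_valued X /\
  exists2 s : seq R, itv_partition 0 1 s &
    forall k : nat, (k < size s)%N ->
      smooth_on `[nth 1 (0 :: s) k, nth 1 (0 :: s) k.+1] X.

(* For a piecewise smooth curve the velocity is arbitrary at the finitely many
   break points, which are negligible. *)
Definition curve_length (R : realType) (n : nat) (X : R -> 'M[R[i]]_n) : \bar R :=
  (\int[lebesgue_measure]_(t in `[0%R, 1%R]) (trace_norm (velocity X t))%:E)%E.

Definition minimal_curve (R : realType) (n : nat) (X : R -> 'M[R[i]]_n) : Prop :=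
  piecewise_smooth_curve X /\
  forall Y : R -> 'M[R[i]]_n, piecewise_smooth_curve Y ->
    Y 0 = X 0 -> Y 1 = X 1 -> (curve_length X <= curve_length Y)%E.

Definition minimal_curve_joining (R : realType) (n : nat) (A B : 'M[R[i]]_n)
    (X : R -> 'M[R[i]]_n) : Prop :=
  [/\ X 0 = A, X 1 = B & minimal_curve X].

(* Operators between the coordinate subspaces span {e_k : k in K} and
   span {e_j : j in J} are represented by their matrices in the orthonormal
   bases (e_k)_(k in K) and (e_j)_(j in J), listed in increasing order; thus
   H(span {e_j : j in J}) is the space of Hermitian matrices of size #|J|, and
   block J K A is the compression of A from the former to the latter. *)
Definition block (R : realType) (n : nat) (J K : {set 'I_n}) (A : 'M[R[i]]_n) :
    'M[R[i]]_(#|J|, #|K|) :=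
  \matrix_(a, b) A (enum_val a) (enum_val b).

Definition block3 (R : realType) (n : nat) (J1 J2 J3 : {set 'I_n})
    (A : 'M[R[i]]_n) : 'M[R[i]]_(#|J1| + (#|J2| + #|J3|)) :=
  block_mx
    (block J1 J1 A) (row_mx (block J1 J2 A) (block J1 J3 A))
    (col_mx (block J2 J1 A) (block J3 J1 A))
    (block_mx (block J2 J2 A) (block J2 J3 A)
              (block J3 J2 A) (block J3 J3 A)).

Definition real_diag (R : realType) (n : nat) (d : 'I_n -> R) : 'M[R[i]]_n :=
  diag_mx (\row_j (d j)%:C).

Definition pos_idx (R : realType) (n : nat) (d : 'I_n -> R) : {set 'I_n} :=
  [set j : 'I_n | 0 < d j].
Definition zero_idx (R : realType) (n : nat) (d : 'I_n -> R) : {set 'I_n} :=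
  [set j : 'I_n | d j == 0].
Definition neg_idx (R : realType) (n : nat) (d : 'I_n -> R) : {set 'I_n} :=
  [set j : 'I_n | d j < 0].

(* Main.v *)
(* Write D for diag d and E for the diagonal matrix of the signs of the d_j.
   For Hermitian U with |v* U v| <= v* v for all v, and Hermitian A, duality
   gives tr(U A) <= ||A||_1; hence every curve Y that is piecewise smooth
   satisfies L(Y) >= tr(U (Y(1) - Y(0))) by the fundamental theorem of calculus.
   Since tr(E D) = ||D||_1 is the length of the segment t D, the curve X is
   minimal iff ||X'(t)||_1 = tr(E X'(t)) for all t.  For a Hermitian matrix A,
   diagonalising A shows that ||A||_1 = tr(E A) iff |A| = A E = E A, which says
   that A vanishes outside its S1- and S3-blocks and that these are
   respectively positive and negative semidefinite. *)

Require Import Defs.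
From HB Require Import structures.
From mathcomp Require Import all_boot all_order all_algebra.
From mathcomp Require Import spectral complex.
From mathcomp Require Import all_classical all_reals all_analysis.
From mathcomp Require Import measurable_realfun.

Set Implicit Arguments.
Unset Strict Implicit.
Unset Printing Implicit Defensive.

Import Order.TTheory GRing.Theory Num.Theory.
Import numFieldNormedType.Exports.

Local Open Scope classical_set_scope.
Local Open Scope ring_scope.
Local Open Scope complex_scope.
Local Open Scope sesquilinear_scope.

(** * Hermitian matrices *)

Section HermitianMatrices.
Context {C : numClosedFieldType}.

(** The eigenbasis inside the definition of |A| is an arbitrary choice. Explicit absolute values
    therefore come from uniqueness of the positive square root, which admits any convenient
    eigenbasis or a direct candidate such as E A. Two analytic obstacles shape the rest. The
    velocity of a competitor is uncontrolled at its break points, and measurability of its trace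
    norm is not at hand; lengths are therefore bounded below through the scalar functions t -> Re
    tr(U Y'(t)), whose integrals depend only on the endpoints. Moreover, minimality yields only an
    equality of integrals, whereas the block structure needs ||X'(t)||_1 = tr(E X'(t)) at every t,
    endpoints included; the passage rests on continuity of these pairings, with a second contraction
    adapted to one instant at a time. The block form passes from X' to X because an entry with zero
    velocity is constant and X(0) = 0. *)

Lemma hermP n (A : 'M[C]_n) : reflect (A ^t* = A) (A \is hermsymmx).
Proof.
by apply: (iffP (is_hermitianmxP _ _ _)); rewrite expr0 scale1r => /esym.
Qed.

Lemma adjmxM m n p (A : 'M[C]_(m, n)) (B : 'M[C]_(n, p)) :
  (A *m B) ^t* = B ^t* *m A ^t*.
Proof. by rewrite trmx_mul map_mxM. Qed.

Lemma adj_diag_mx n (l : 'rV[C]_n) :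
  (forall i, l 0 i \is Num.real) -> (diag_mx l) ^t* = diag_mx l.
Proof.
move=> lr; apply/matrixP => i j; rewrite !mxE eq_sym.
by case: eqP => [->|_]; rewrite ?mulr1n ?mulr0n ?conj_Creal ?lr ?conjC0.
Qed.

Definition posmx n (A : 'M[C]_n) : Prop :=
  forall v : 'cV[C]_n, 0 <= (v ^t* *m A *m v) 0 0.

Lemma unitary_adjM n (W : 'M[C]_n) : W \is unitarymx -> W ^t* *m W = 1%:M.
Proof.
move=> Wu; rewrite -[W in _ *m W]trmxCK.
by apply/unitarymxP; rewrite trmxC_unitary.
Qed.

(** Rows of a unitary matrix serve as test vectors: positivity or a contraction bound on them
    controls the diagonal entries in the basis given by [W]. *)
Lemma qform_row n (W A : 'M[C]_n) i :
  (((row i W) ^t*) ^t* *m A *m (row i W) ^t*) 0 0 = (W *m A *m W ^t*) i i.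
Proof.
rewrite trmxCK -row_mul [LHS]mxE [RHS]mxE.
by apply: eq_bigr => j _; rewrite !mxE.
Qed.

Lemma qform_diag n (l : 'rV[C]_n) (v : 'cV[C]_n) :
  (v ^t* *m diag_mx l *m v) 0 0 = \sum_j l 0 j * `|v j 0| ^+ 2.
Proof.
rewrite mxE; apply: eq_bigr => j _.
by rewrite mul_mx_diag !mxE mulrAC mulrC normCKC.
Qed.

Lemma qform1 n (v : 'cV[C]_n) : (v ^t* *m v) 0 0 = \sum_j `|v j 0| ^+ 2.
Proof. by rewrite mxE; apply: eq_bigr => j _; rewrite !mxE normCKC. Qed.

Lemma herm_unitary_diag n (A : 'M[C]_n) : A \is hermsymmx ->
  exists (W : 'M[C]_n) (l : 'rV[C]_n),
    [/\ W \is unitarymx, forall i, l 0 i \is Num.real &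
        A = W ^t* *m diag_mx l *m W].
Proof.
move=> Ah; exists (spectralmx A), (spectral_diag A); split.
- exact: spectral_unitarymx.
- by move=> i; have /mxOverP := hermitian_spectral_diag_real Ah.
- rewrite -(invmx_unitary (spectral_unitarymx A)).
  exact/orthomx_spectralP/hermitian_normalmx.
Qed.

Lemma unitary_diag_mul n (W : 'M[C]_n) (a b : 'rV[C]_n) : W \is unitarymx ->
  (W ^t* *m diag_mx a *m W) *m (W ^t* *m diag_mx b *m W) =
  W ^t* *m diag_mx (\row_i (a 0 i * b 0 i)) *m W.
Proof.
move=> Wu; rewrite !mulmxA (mulmxtVK _ Wu) -!mulmxA; congr (_ *m _).
rewrite !mulmxA; congr (_ *m _); apply/matrixP => i j; rewrite mul_diag_mx !mxE.
by case: eqP; rewrite ?mulr1n ?mulr0n ?mulr0.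
Qed.

Lemma unitary_diag_adj n (W : 'M[C]_n) (a : 'rV[C]_n) :
  (forall i, a 0 i \is Num.real) ->
  (W ^t* *m diag_mx a *m W) ^t* = W ^t* *m diag_mx a *m W.
Proof. by move=> ar; rewrite !adjmxM adj_diag_mx// trmxCK mulmxA. Qed.

Lemma unitary_diag_qform n (W : 'M[C]_n) (a : 'rV[C]_n) (v : 'cV[C]_n) :
  (v ^t* *m (W ^t* *m diag_mx a *m W) *m v) 0 0 =
  \sum_j a 0 j * `|(W *m v) j 0| ^+ 2.
Proof. by rewrite -qform_diag adjmxM !mulmxA. Qed.

Lemma unitary_diag_pos n (W : 'M[C]_n) (a : 'rV[C]_n) :
  (forall i, 0 <= a 0 i) -> posmx (W ^t* *m diag_mx a *m W).
Proof.
move=> a0 v; rewrite unitary_diag_qform sumr_ge0// => i _.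
by rewrite mulr_ge0// exprn_ge0.
Qed.

Lemma unitary_diag_conj n (W : 'M[C]_n) (a : 'rV[C]_n) i : W \is unitarymx ->
  (W *m (W ^t* *m diag_mx a *m W) *m W ^t*) i i = a 0 i.
Proof.
move=> Wu; rewrite !mulmxA (mulmxtVK _ Wu) (unitarymxP Wu) mul1mx mxE eqxx.
by rewrite mulr1n.
Qed.

Lemma unitary_diag_pos_ge0 n (W : 'M[C]_n) (a : 'rV[C]_n) i :
  W \is unitarymx -> posmx (W ^t* *m diag_mx a *m W) -> 0 <= a 0 i.
Proof. by move=> Wu Ap; rewrite -(unitary_diag_conj a i Wu) -qform_row. Qed.

(* In eigenbases of [S] and [T] the transition matrix [M] satisfies
   [a_i^2 M_ij = M_ij b_j^2], hence [a_i M_ij = M_ij b_j]. *)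
Lemma pos_sqrt_unique n (S T : 'M[C]_n) : S \is hermsymmx -> T \is hermsymmx ->
  posmx S -> posmx T -> S *m S = T *m T -> S = T.
Proof.
move=> /herm_unitary_diag[V [a [Vu ar ->]]] /herm_unitary_diag[W [b [Wu br ->]]].
move=> Sp Tp; rewrite !unitary_diag_mul// => ST.
have a0 i := unitary_diag_pos_ge0 i Vu Sp.
have b0 i := unitary_diag_pos_ge0 i Wu Tp.
set M := V *m W ^t*.
have MM : diag_mx a *m M = M *m diag_mx b.
  have /matrixP E : diag_mx (\row_i (a 0 i * a 0 i)) *m M
                  = M *m diag_mx (\row_i (b 0 i * b 0 i)).
    have := congr1 (fun Z => V *m Z *m W ^t*) ST.
    by rewrite !mulmxA !(mulmxtVK _ Wu) (unitarymxP Vu) mul1mx.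
  apply/matrixP => i j; move: (E i j).
  rewrite !mul_diag_mx !mul_mx_diag !mxE => /eqP.
  rewrite [_ * (b 0 j * _)]mulrC -subr_eq0 -mulrBl mulf_eq0 -!expr2.
  case/orP => [|/eqP ->]; last by rewrite mulr0 mul0r.
  rewrite subr_eq0 eqrXn2 // => /eqP ->; exact: mulrC.
have := congr1 (fun Z => V ^t* *m Z *m W) MM.
by rewrite !mulmxA -[_ *m W ^t* *m W]mulmxA unitary_adjM// mulmx1 unitary_adjM// mul1mx.
Qed.

(** Numerical radius at most 1, which for Hermitian matrices is operator norm at most 1. The
    quadratic form is bounded because duality only looks at diagonal entries in unitary bases. *)
Definition contraction_mx n (U : 'M[C]_n) : Prop :=
  forall v : 'cV[C]_n, `|(v ^t* *m U *m v) 0 0| <= (v ^t* *m v) 0 0.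

Lemma unitary_diag_contraction n (W : 'M[C]_n) (s : 'rV[C]_n) :
  W \is unitarymx -> (forall i, `|s 0 i| <= 1) ->
  contraction_mx (W ^t* *m diag_mx s *m W).
Proof.
move=> Wu s1 v; rewrite unitary_diag_qform.
have -> : v ^t* *m v = (W *m v) ^t* *m (W *m v).
  by rewrite adjmxM mulmxA -[_ *m W ^t* *m W]mulmxA unitary_adjM// mulmx1.
rewrite qform1 (le_trans (ler_norm_sum _ _ _))// ler_sum// => i _.
by rewrite normrM normrX normr_id ler_piMl// exprn_ge0.
Qed.

Lemma contraction_unitary_conj n (U W : 'M[C]_n) i : contraction_mx U ->
  W \is unitarymx -> `|(W *m U *m W ^t*) i i| <= 1.
Proof.
move=> Uc Wu; rewrite -qform_row; apply: (le_trans (Uc _)).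
suff -> : (((row i W) ^t*) ^t* *m (row i W) ^t*) 0 0 = 1 by [].
by rewrite -[X in (X *m _) 0 0]mulmx1 qform_row mulmx1 (unitarymxP Wu) mxE eqxx.
Qed.

Lemma trace_unitary_diag n (U W : 'M[C]_n) (l : 'rV[C]_n) :
  \tr (U *m (W ^t* *m diag_mx l *m W)) = \sum_i (W *m U *m W ^t*) i i * l 0 i.
Proof.
rewrite !mulmxA mxtrace_mulC !mulmxA /mxtrace; apply: eq_bigr => i _.
by rewrite mul_mx_diag !mxE.
Qed.

Lemma qform_adj_mul n (A : 'M[C]_n) (v : 'cV[C]_n) :
  (v ^t* *m (A ^t* *m A) *m v) 0 0 = \sum_j `|(A *m v) j 0| ^+ 2.
Proof. by rewrite -qform1 adjmxM !mulmxA. Qed.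


(** The formula of [absmx] over any numerically closed field; over [R[i]] the two are
    convertible. *)
Definition abs_mx n (A : 'M[C]_n) : 'M[C]_n :=
  let B := A ^t* *m A in
  invmx (spectralmx B) *m diag_mx (map_mx sqrtC (spectral_diag B))
    *m spectralmx B.

Section AbsMx.
Context {n : nat} (A : 'M[C]_n).

Let B := A ^t* *m A.
Let V := spectralmx B.
Let b := spectral_diag B.
Let Vu : V \is unitarymx := spectral_unitarymx B.

Let BE : B = V ^t* *m diag_mx b *m V.
Proof.
rewrite -(invmx_unitary Vu); apply/orthomx_spectralP/hermitian_normalmx/hermP.
by rewrite adjmxM trmxCK.
Qed.

Let b_ge0 i : 0 <= b 0 i.
Proof.
apply: (unitary_diag_pos_ge0 _ Vu) => v; rewrite -BE qform_adj_mul.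
by rewrite sumr_ge0// => j _; rewrite exprn_ge0.
Qed.

Let absE : abs_mx A = V ^t* *m diag_mx (map_mx sqrtC b) *m V.
Proof. by rewrite /abs_mx -/B -/V (invmx_unitary Vu). Qed.

Lemma abs_mx_herm : abs_mx A \is hermsymmx.
Proof.
apply/hermP; rewrite absE unitary_diag_adj// => i.
by rewrite mxE ger0_real// sqrtC_ge0.
Qed.

Lemma abs_mx_pos : posmx (abs_mx A).
Proof. by rewrite absE; apply: unitary_diag_pos => i; rewrite mxE sqrtC_ge0. Qed.

Lemma abs_mx_sqr : abs_mx A *m abs_mx A = A ^t* *m A.
Proof.
rewrite absE unitary_diag_mul// -/B BE; congr (_ *m diag_mx _ *m _).
by apply/rowP => i; rewrite !mxE -expr2 sqrtCK.
Qed.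

(** The means of computing an absolute value, whatever eigenbasis the definition picked. *)
Lemma abs_mx_unique (S : 'M[C]_n) : S \is hermsymmx -> posmx S ->
  S *m S = A ^t* *m A -> abs_mx A = S.
Proof.
move=> Sh Sp SA; apply: (pos_sqrt_unique abs_mx_herm Sh abs_mx_pos Sp).
by rewrite abs_mx_sqr.
Qed.

Lemma trace_abs_ge0 : 0 <= \tr (abs_mx A).
Proof.
have := @trace_unitary_diag n 1%:M V (map_mx sqrtC b).
rewrite mul1mx -absE mulmx1 => ->; rewrite sumr_ge0// => i _.
by rewrite (unitarymxP Vu) !mxE eqxx mul1r sqrtC_ge0.
Qed.

End AbsMx.

Lemma abs_mx_unitary_diag n (W : 'M[C]_n) (l : 'rV[C]_n) : W \is unitarymx ->
  (forall i, l 0 i \is Num.real) ->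
  abs_mx (W ^t* *m diag_mx l *m W) =
  W ^t* *m diag_mx (map_mx Num.norm l) *m W.
Proof.
move=> Wu lr; apply: abs_mx_unique.
- by apply/hermP; rewrite unitary_diag_adj// => i; rewrite mxE normr_real.
- by apply: unitary_diag_pos => i; rewrite mxE.
- rewrite (unitary_diag_adj _ lr) !unitary_diag_mul//.
  congr (_ *m diag_mx _ *m _).
  by apply/rowP => i; rewrite !mxE -!expr2 real_normK.
Qed.

Lemma trace_abs_unitary_diag n (W : 'M[C]_n) (l : 'rV[C]_n) :
  W \is unitarymx -> (forall i, l 0 i \is Num.real) ->
  \tr (abs_mx (W ^t* *m diag_mx l *m W)) = \sum_i `|l 0 i|.
Proof.
move=> Wu lr; rewrite abs_mx_unitary_diag//.
rewrite -[X in \tr X]mul1mx trace_unitary_diag mulmx1 (unitarymxP Wu).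
by apply: eq_bigr => i _; rewrite !mxE eqxx mul1r.
Qed.

(** In an eigenbasis of [A] the trace is the sum of the eigenvalues weighted by diagonal entries of
    [U], each of modulus at most 1. *)
Lemma trace_abs_ge_contraction n (A U : 'M[C]_n) : A \is hermsymmx ->
  contraction_mx U -> `|\tr (U *m A)| <= \tr (abs_mx A).
Proof.
move=> /herm_unitary_diag[W [l [Wu lr ->]]] Uc.
rewrite trace_abs_unitary_diag// trace_unitary_diag.
rewrite (le_trans (ler_norm_sum _ _ _))// ler_sum// => i _.
by rewrite normrM ler_piMl// contraction_unitary_conj.
Qed.

Lemma trace_abs_attained n (A : 'M[C]_n) : A \is hermsymmx ->
  exists2 U : 'M[C]_n, contraction_mx U & \tr (U *m A) = \tr (abs_mx A).
Proof.
move=> /herm_unitary_diag[W [l [Wu lr ->]]].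
(* The sign function of [A]; the value at a zero eigenvalue does not affect the trace. *)
exists (W ^t* *m diag_mx (\row_i (if 0 <= l 0 i then 1 else -1)) *m W).
  apply: unitary_diag_contraction => // i; rewrite mxE.
  by case: ifP => _; rewrite ?normrN normr1.
rewrite abs_mx_unitary_diag// unitary_diag_mul//.
congr (\tr (_ *m diag_mx _ *m _)).
apply/rowP => i; rewrite !mxE; case: ifPn => [l0|]; first by rewrite mul1r ger0_norm.
by rewrite -real_ltNge ?real0// => l0; rewrite mulN1r ltr0_norm.
Qed.

Lemma contraction_mx1 n : contraction_mx (1%:M : 'M[C]_n).
Proof.
by move=> v; rewrite mulmx1 ger0_norm// qform1 sumr_ge0// => i _; rewrite exprn_ge0.
Qed.

Lemma contraction_mxN n (U : 'M[C]_n) : contraction_mx U -> contraction_mx (- U).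
Proof. by move=> Uc v; rewrite mulmxN mulNmx mxE normrN. Qed.

Lemma abs_mx_id n (A : 'M[C]_n) : A \is hermsymmx -> posmx A -> abs_mx A = A.
Proof. by move=> Ah Ap; apply: abs_mx_unique => //; rewrite (hermP _ Ah). Qed.

Lemma hermN n (A : 'M[C]_n) : A \is hermsymmx -> - A \is hermsymmx.
Proof. by move=> /hermP Ah; apply/hermP; rewrite linearN /= map_mxN Ah. Qed.

Lemma abs_mx_opp n (A : 'M[C]_n) : A \is hermsymmx -> posmx (- A) ->
  abs_mx A = - A.
Proof.
move=> Ah Ap; apply: abs_mx_unique => //; first exact: hermN.
by rewrite mulmxN mulNmx opprK (hermP _ Ah).
Qed.

Lemma trace_mul_herm_real n (A B : 'M[C]_n) : A \is hermsymmx ->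
  B \is hermsymmx -> \tr (A *m B) \is Num.real.
Proof.
move=> /hermP Ah /hermP Bh; rewrite CrealE -trace_map_mx -mxtrace_tr map_trmx.
by rewrite adjmxM Ah Bh mxtrace_mulC.
Qed.

Lemma diag_contraction n (e : 'rV[C]_n) : (forall i, `|e 0 i| <= 1) ->
  contraction_mx (diag_mx e).
Proof.
move=> e1; have := @unitary_diag_contraction n 1%:M e.
rewrite mulmx1 trmx1 map_mx1 mul1mx; apply => //.
by apply/unitarymxP; rewrite trmx1 map_mx1 mulmx1.
Qed.

(* In an eigenbasis [W] of [A], with eigenvalues [l], the defect is the sum of
   the nonnegative terms [(|l_i| - e_j l_i) |W_ij|^2], all of which vanish. *)
Lemma trace_abs_eq_diag n (A : 'M[C]_n) (e : 'rV[C]_n) : A \is hermsymmx ->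
  (forall i, e 0 i \is Num.real) -> (forall i, `|e 0 i| <= 1) ->
  \tr (diag_mx e *m A) = \tr (abs_mx A) ->
  abs_mx A = A *m diag_mx e.
Proof.
move=> /herm_unitary_diag[W [l [Wu lr ->]]] er e1 tnE.
pose r i j := (`|l 0 i| - e 0 j * l 0 i) * `|W i j| ^+ 2.
have r_ge0 i j : 0 <= r i j.
  rewrite mulr_ge0 ?exprn_ge0// subr_ge0 (le_trans (real_ler_norm _))//.
    by rewrite realM.
  by rewrite normrM ler_piMl.
have WEW i : (W *m diag_mx e *m W ^t*) i i = \sum_j e 0 j * `|W i j| ^+ 2.
  rewrite mxE; apply: eq_bigr => j _.
  by rewrite mul_mx_diag !mxE mulrAC mulrC normCK.
have W1 i : \sum_j `|W i j| ^+ 2 = 1.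
  have /matrixP/(_ i i) := unitarymxP Wu.
  rewrite [RHS]mxE eqxx mulr1n => <-; rewrite mxE.
  by apply: eq_bigr => j _; rewrite !mxE normCK.
have r0 : \sum_i \sum_j r i j = 0.
  have -> : \sum_i \sum_j r i j =
      \sum_i `|l 0 i| - \sum_i (W *m diag_mx e *m W ^t*) i i * l 0 i.
    rewrite -sumrB; apply: eq_bigr => i _.
    rewrite WEW -[X in X - _]mulr1 -(W1 i) mulr_sumr mulr_suml -sumrB.
    by apply: eq_bigr => j _; rewrite /r mulrBl mulrAC.
  by rewrite -trace_unitary_diag tnE trace_abs_unitary_diag// subrr.
have rij i j : r i j = 0.
  move/eqP: r0; rewrite psumr_eq0; last by move=> k _; apply: sumr_ge0.
  move=> /allP/(_ i (mem_index_enum _))/=; rewrite psumr_eq0//.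
  by move=> /allP/(_ j (mem_index_enum _))/= /eqP.
rewrite abs_mx_unitary_diag// -!mulmxA; congr (_ *m _).
apply/matrixP => i j; rewrite mul_diag_mx mulmxA mul_mx_diag mul_diag_mx !mxE.
have /eqP := rij i j; rewrite mulf_eq0 sqrf_eq0 normr_eq0 => /orP[|/eqP ->].
  by rewrite subr_eq0 => /eqP ->; rewrite [RHS]mulrC mulrA.
by rewrite !(mulr0, mul0r).
Qed.

Lemma posmx_congr m n (A : 'M[C]_n) (Q : 'M[C]_(n, m)) :
  posmx A -> posmx (Q ^t* *m A *m Q).
Proof. by move=> Ap v; have := Ap (Q *m v); rewrite adjmxM !mulmxA. Qed.

Lemma posmxD n (A B : 'M[C]_n) : posmx A -> posmx B -> posmx (A + B).
Proof. by move=> Ap Bp v; rewrite mulmxDr mulmxDl mxE addr_ge0. Qed.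

(** * Coordinate subspaces and their inclusions *)

Section Blocks.
Context {n : nat}.
Implicit Types (S : {set 'I_n}) (A : 'M[C]_n).

(** The isometric inclusion of the coordinate subspace. It makes compression to a block a
    congruence, which preserves positivity. *)
Definition incl_mx S : 'M[C]_(n, #|S|) := \matrix_(j, a) (j == enum_val a)%:R.

Lemma incl_mx_adj S a j : (incl_mx S) ^t* a j = (j == enum_val a)%:R.
Proof. by rewrite !mxE conjC_nat. Qed.

Lemma incl_mx_proj S :
  incl_mx S *m (incl_mx S) ^t* = diag_mx (\row_j (j \in S)%:R).
Proof.
apply/matrixP => j k; rewrite [LHS]mxE.
under eq_bigr do rewrite incl_mx_adj [incl_mx _ _ _]mxE.
rewrite !mxE; have [jS|jS] := boolP (j \in S).
  rewrite (bigD1 (enum_rank_in jS j))//= enum_rankK_in// eqxx mul1r.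
  rewrite big1 ?addr0 => [|a aj]; first by rewrite eq_sym.
  case: eqP => [/(congr1 (enum_rank_in jS))|_]; last by rewrite mul0r.
  by rewrite enum_valK_in => ja; rewrite ja eqxx in aj.
rewrite big1 ?mul0rn// => a _; case: eqP => [ja|_]; last by rewrite mul0r.
by rewrite ja enum_valP in jS.
Qed.

Lemma diag_incl_mx (e : 'rV[C]_n) S c :
  {in S, forall j, e 0 j = c} -> diag_mx e *m incl_mx S = c *: incl_mx S.
Proof.
move=> ec; apply/matrixP => j a; rewrite mul_diag_mx !mxE.
by case: eqP => [->|_]; rewrite ?mulr0// ec// enum_valP.
Qed.

End Blocks.

(** * The sign matrix and the equality |A| = A E *)

Section SignBlocks.
Context {n : nat} (S1 S3 : {set 'I_n}).
Hypothesis S13 : {in S1, forall j, j \in S3 = false}.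
Implicit Type A : 'M[C]_n.

Let S31 : {in S3, forall j, j \in S1 = false}.
Proof. by move=> j j3; apply/negP => /S13; rewrite j3. Qed.

Definition sign_row : 'rV[C]_n := \row_j ((j \in S1)%:R - (j \in S3)%:R).

Definition sign_mx : 'M[C]_n := diag_mx sign_row.

(** An index outside [S1] and [S3] has the same sign as no index, itself included, so the negation
    also covers the middle block. *)
Definition same_sign (j k : 'I_n) : bool :=
  (j \in S1) && (k \in S1) || (j \in S3) && (k \in S3).

Lemma sign_rowE j :
  sign_row 0 j = if j \in S1 then 1 else if j \in S3 then -1 else 0.
Proof.
rewrite mxE; have [j1|j1] := boolP (j \in S1); last by case: ifP; rewrite ?subrr ?sub0r.
by rewrite (S13 j1) subr0.
Qed.

Lemma sign_row_real j : sign_row 0 j \is Num.real.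
Proof. by rewrite mxE realB// realn. Qed.

Lemma sign_row_le1 j : `|sign_row 0 j| <= 1.
Proof.
by rewrite sign_rowE; do 2?case: ifP; rewrite ?normrN ?normr1 ?normr0 ?ler01 ?lexx.
Qed.

Lemma sign_row_pos : {in S1, forall j, sign_row 0 j = 1}.
Proof. by move=> j j1; rewrite sign_rowE j1. Qed.

Lemma sign_row_neg : {in S3, forall j, sign_row 0 j = -1}.
Proof. by move=> j j3; rewrite sign_rowE j3 (S31 j3). Qed.

Lemma sign_mx_adj : sign_mx ^t* = sign_mx.
Proof. by rewrite adj_diag_mx//; exact: sign_row_real. Qed.

Lemma sign_mx_contraction : contraction_mx sign_mx.
Proof. exact/diag_contraction/sign_row_le1. Qed.

Lemma mul_sign_mx A j k : (sign_mx *m A) j k = sign_row 0 j * A j k.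
Proof. by rewrite /sign_mx mul_diag_mx mxE. Qed.

Lemma mul_mx_sign A j k : (A *m sign_mx) j k = A j k * sign_row 0 k.
Proof. by rewrite /sign_mx mul_mx_diag mxE. Qed.

Section Forward.
Context (A : 'M[C]_n).
Hypotheses (Ah : A \is hermsymmx) (AE : abs_mx A = A *m sign_mx).

(** The adjoint of [AE], all three matrices being Hermitian. *)
Lemma abs_sign_comm : sign_mx *m A = abs_mx A.
Proof.
have /hermP := abs_mx_herm A.
by rewrite {1}AE adjmxM sign_mx_adj (hermP _ Ah).
Qed.

(** Two mechanisms. If [k] has sign 0, column [k] of |A| = A E is zero, so the [k]-th diagonal entry
    of the square of |A|, which is the squared norm of column [k] of [A], is zero. Otherwise
    commutation with E gives e_j A_jk = A_jk e_k with e_j different from e_k. *)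
Lemma abs_sign_eq0 j k : ~~ same_sign j k -> A j k = 0.
Proof.
have col0 : k \notin S1 -> k \notin S3 -> A j k = 0.
  move=> k1 k3; have /matrixP/(_ k k) := abs_mx_sqr A.
  have e0 : sign_row 0 k = 0 by rewrite sign_rowE (negPf k1) (negPf k3).
  rewrite mxE big1 => [|i _]; last by rewrite {2}AE mul_mx_sign e0 !mulr0.
  rewrite mxE => /esym/eqP; under eq_bigr do rewrite !mxE -normCKC.
  rewrite psumr_eq0 => [|i _]; last by rewrite exprn_ge0.
  by move=> /allP/(_ j (mem_index_enum _)); rewrite /= sqrf_eq0 normr_eq0 => /eqP.
have : (sign_mx *m A) j k = (A *m sign_mx) j k by rewrite abs_sign_comm AE.
rewrite mul_sign_mx mul_mx_sign /same_sign !sign_rowE.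
have [k1|k1] := boolP (k \in S1); rewrite /= ?mulr1 ?andbT ?andbF.
  have -> : (k \in S3) = false by rewrite S13.
  rewrite andbF orbF => + /negPf j1; rewrite j1.
  case: ifP => _; first by rewrite mulN1r => /eqP; rewrite eqNr => /eqP.
  by rewrite mul0r => <-.
have [k3|k3] := boolP (k \in S3); last by move=> _ _; exact: col0.
rewrite andbT orFb => + /negPf j3; rewrite j3 mulrN1.
case: ifP => _; first by rewrite mul1r => /esym/eqP; rewrite eqNr => /eqP.
by rewrite mul0r => /esym/eqP; rewrite oppr_eq0 => /eqP.
Qed.

(** On the range of [incl_mx S1] the sign matrix acts as 1, so the block of [A] is a block of the
    positive matrix |A| = A E. *)
Lemma abs_sign_pos : posmx ((incl_mx S1) ^t* *m A *m incl_mx S1).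
Proof.
have -> : (incl_mx S1) ^t* *m A *m incl_mx S1 =
    (incl_mx S1) ^t* *m A *m (sign_mx *m incl_mx S1).
  by rewrite (diag_incl_mx sign_row_pos) scale1r.
by rewrite mulmxA -[_ *m A *m _]mulmxA -AE; exact/posmx_congr/abs_mx_pos.
Qed.

Lemma abs_sign_neg : posmx (- ((incl_mx S3) ^t* *m A *m incl_mx S3)).
Proof.
have -> : - ((incl_mx S3) ^t* *m A *m incl_mx S3) =
    (incl_mx S3) ^t* *m A *m (sign_mx *m incl_mx S3).
  by rewrite (diag_incl_mx sign_row_neg) scaleN1r mulmxN.
by rewrite mulmxA -[_ *m A *m _]mulmxA -AE; exact/posmx_congr/abs_mx_pos.
Qed.

End Forward.

(** The candidate E A is Hermitian, squares to A^2, and is positive as the S1-block minus the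
    S3-block, both extended by zero; the positive square root is unique. *)
Lemma abs_sign_blocks A : A \is hermsymmx ->
  (forall j k, ~~ same_sign j k -> A j k = 0) ->
  posmx ((incl_mx S1) ^t* *m A *m incl_mx S1) ->
  posmx (- ((incl_mx S3) ^t* *m A *m incl_mx S3)) ->
  abs_mx A = sign_mx *m A.
Proof.
move=> /hermP Ah A0 Ap An.
have EA : sign_mx *m A = A *m sign_mx.
  apply/matrixP => j k; rewrite mul_sign_mx mul_mx_sign mulrC.
  have [|/A0 ->] := boolP (same_sign j k); last by rewrite !mul0r.
  by case/orP => /andP[dj dk]; [rewrite !sign_row_pos|rewrite !sign_row_neg].
(* E^2 is only the projection onto the span of [S1] and [S3], but the other rows of [A] vanish. *)
have EEA : sign_mx *m (sign_mx *m A) = A.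
  apply/matrixP => j k; rewrite !mul_sign_mx.
  have [|/A0 ->] := boolP (same_sign j k); last by rewrite !mulr0.
  case/orP => /andP[dj dk]; first by rewrite sign_row_pos// !mul1r.
  by rewrite sign_row_neg// !mulN1r opprK.
apply: abs_mx_unique.
- by apply/hermP; rewrite adjmxM Ah sign_mx_adj EA.
- have -> : sign_mx *m A =
      incl_mx S1 *m ((incl_mx S1) ^t* *m A *m incl_mx S1) *m (incl_mx S1) ^t*
    + incl_mx S3 *m - ((incl_mx S3) ^t* *m A *m incl_mx S3) *m (incl_mx S3) ^t*.
    rewrite mulmxN mulNmx !mulmxA !incl_mx_proj -!mulmxA !incl_mx_proj.
    apply/matrixP => j k; rewrite mul_sign_mx [RHS]mxE [X in _ + X]mxE.
    rewrite !mulmxA !mul_mx_diag !mul_diag_mx !mxE.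
    have [|/A0 ->] := boolP (same_sign j k); last by rewrite !(mulr0,mul0r) subrr.
    case/orP => /andP[dj dk]; rewrite dj dk.
      by rewrite (S13 dj) subr0 !mul0r subr0 mulr1.
    by rewrite (S31 dj) sub0r !mul0r sub0r mulN1r mul1r mulr1.
  by apply: posmxD; rewrite -[X in X *m _ *m _]trmxCK; apply: posmx_congr.
- by rewrite Ah -mulmxA [A *m (sign_mx *m A)]mulmxA -EA mulmxA EEA.
Qed.

End SignBlocks.

End HermitianMatrices.

(** * Derivatives relative to an interval and their integrals *)

Section RelativeDerivative.
Context {R : realType}.
Implicit Types (f g : R -> R) (I : set R) (t : R).

Lemma within_dnbhs I t : nbhs t I -> within I t^' = t^'.
Proof.
move=> It; apply/predeqP => A; split => [|]; last exact: cvg_within.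
rewrite /dnbhs /within /= => tA; apply: filterS2 It tA => s Is + st; exact.
Qed.

Lemma derive_on_interior I f t : nbhs t I ->
  derive_on I f t = lim (diff_quot f t @ t^').
Proof. by move=> It; rewrite /derive_on within_dnbhs. Qed.

Lemma diff_quot_congr I f g t : I t -> (forall s, I s -> f s = g s) ->
  diff_quot f t @ within I t^' = diff_quot g t @ within I t^'.
Proof.
move=> It fg; apply/predeqP => A; rewrite /nbhs/= /fmap /= /within /=.
by split; apply: filterS => s + Is; rewrite /= /diff_quot !fg//; apply.
Qed.

Lemma derive_on_congr I f g t : I t -> (forall s, I s -> f s = g s) ->
  derive_on I f t = derive_on I g t.
Proof. by move=> It fg; rewrite /derive_on (diff_quot_congr It fg). Qed.

Lemma derivable_on_congr I f g t : I t -> (forall s, I s -> f s = g s) ->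
  derivable_on I f t -> derivable_on I g t.
Proof. by move=> It fg; rewrite /derivable_on (diff_quot_congr It fg). Qed.

Lemma smooth_fun_on_congr I f g : (forall s, I s -> f s = g s) ->
  smooth_fun_on I f -> smooth_fun_on I g.
Proof.
move=> fg fI k t It.
have E s : I s -> iter k (derive_on I) f s = iter k (derive_on I) g s.
  elim: k s => [|k IH] s Is /=; first exact: fg.
  exact: derive_on_congr.
exact: derivable_on_congr It E (fI k t It).
Qed.

(** Away from t, f(s) = f(t) + (s - t) q(s) with q the difference quotient, which converges; the
    point s = t, absent from the deleted filter, is trivial. *)
Lemma derivable_on_cvg I f t : derivable_on I f t ->
  f @ within I (nbhs t) --> f t.
Proof.
move=> ft; have tt : (fun s => s - t) @ within I t^' --> (0 : R).
  apply: cvg_trans (_ : (fun s => s - t) @ nbhs t --> (0 : R)).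
    by apply: cvg_app; apply: cvg_trans (@nbhs_dnbhs _ t); apply: cvg_within.
  by rewrite -(subrr t); apply: cvgB; [exact: cvg_id|exact: cvg_cst].
have h : (fun s => f t + (s - t) * diff_quot f t s) @ within I t^' --> f t.
  rewrite -[X in _ --> X]addr0 -(mul0r (lim (diff_quot f t @ within I t^'))).
  by apply: cvgD; [exact: cvg_cst|exact: cvgM].
apply/cvgrPdist_lt => e e0.
have : \forall s \near within I t^', `|f t - (f t + (s - t) * diff_quot f t s)| < e.
  exact: cvgr_dist_lt h _ e0.
rewrite !near_withinE.
apply: filterS => s /= hs Is.
have [->|st] := eqVneq s t; first by rewrite subrr normr0.
have := hs st Is.
by rewrite /= /diff_quot mulrA mulfV ?mul1r ?subr_eq0// addrCA subrr addr0.
Qed.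

Lemma derivable_on_is_derive I f t : nbhs t I -> derivable_on I f t ->
  is_derive t 1 f (derive_on I f t).
Proof.
move=> It ft; rewrite derive_on_interior//.
have ft' : diff_quot f t @ t^' --> lim (diff_quot f t @ t^').
  by move: ft; rewrite /derivable_on within_dnbhs.
have h : (fun h => h^-1 *: (f (h *: 1 + t) - f t)) @ 0^' -->
    lim (diff_quot f t @ t^').
  apply/cvgrPdist_lt => e e0.
  have : \forall s \near t^', `|lim (diff_quot f t @ t^') - diff_quot f t s| < e.
    exact: cvgr_dist_lt ft' _ e0.
  case=> d /= d0 dP; exists d => // s.
  rewrite /ball_ /= sub0r normrN => sd s0; have := dP (s + t); rewrite /diff_quot /=.
  rewrite opprD addrCA subrr addr0 normrN addrK => /(_ sd).
  rewrite [_ *: 1]mulr1; apply.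
  by rewrite -subr_eq0 addrK.
by apply: DeriveDef; [apply/cvg_ex; exists (lim (diff_quot f t @ t^'))|exact/cvg_lim].
Qed.

Lemma smooth_fun_on_continuous I f k : smooth_fun_on I f ->
  {within I, continuous (iter k (derive_on I) f)}.
Proof.
move=> fI; apply/subspace_continuousP => t It.
by apply: derivable_on_cvg; exact: fI.
Qed.

End RelativeDerivative.

(** * The fundamental theorem of calculus for piecewise smooth functions *)

Section Increment.
Context {R : realType}.
Local Notation mu := (@lebesgue_measure R).
Implicit Types (f g : R -> R) (a b t : R).

Lemma nbhs_itvcc a b t : a < t < b -> nbhs t `[a, b]%classic.
Proof.
move=> tab; have : \forall z \near t, z \in `]a, b[.
  by apply: near_in_itvoo; rewrite in_itv.
by apply: filterS => z; rewrite /= !in_itv /= => /andP[/ltW -> /ltW ->].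
Qed.

Lemma derive_on_subitv a b c e f t : c <= a -> b <= e -> a < t < b ->
  derive_on `[c, e] f t = derive_on `[a, b] f t.
Proof.
move=> ca be /andP[at_ tb]; rewrite !derive_on_interior//; apply: nbhs_itvcc.
  by rewrite at_.
by rewrite (le_lt_trans ca at_) (lt_le_trans tb be).
Qed.

(** Integrability travels with the value because additivity of extended-real integrals asks for
    it. *)
Definition itv_integral a b g v : Prop :=
  mu.-integrable `[a, b] (EFin \o g) /\
  (\int[mu]_(t in `[a, b]) (g t)%:E = v%:E)%E.

(** Serves to change the reference interval of a derivative: relative to a piece or to the whole
    interval, the derivatives agree inside the piece but perhaps not at its ends. *)
Lemma itv_integral_eq_oo a b f g v :
  (forall t, a < t < b -> f t = g t) ->
  itv_integral a b f v -> itv_integral a b g v.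
Proof.
move=> fg [/integrableP[/= mf fi] fv].
have fg' : {in `]a, b[, f =1 g} by move=> t; rewrite in_itv /= => /fg.
have mf' : measurable_fun `]a, b[ f.
  apply: (@measurable_funS _ _ _ _ `[a, b]) => //; first exact: subset_itv_oo_cc.
  exact/measurable_EFinP.
have mg' : measurable_fun `]a, b[ g.
  by apply: eq_measurable_fun mf' => t /set_mem; exact: fg'.
have mg : measurable_fun `[a, b] g by exact: measurable_fun_itv_cc mg'.
split; last by rewrite -fv; apply/esym/eq_integral_itv_bounded.
apply/integrableP; split; first exact/measurable_EFinP.
apply: le_lt_trans fi; rewrite le_eqVlt; apply/orP; left; apply/eqP/esym.
apply: (@eq_integral_itv_bounded _ _ _ (fun t => `|g t|) (fun t => `|f t|)).
- exact: measurableT_comp.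
- exact: measurableT_comp.
- by move=> t tab; rewrite fg'.
Qed.

Lemma itv_integral_derive_on a b f : a < b -> smooth_fun_on `[a, b] f ->
  itv_integral a b (derive_on `[a, b] f) (f b - f a).
Proof.
(* Index 1 selects the derivative: being itself derivable relative to the segment, it is continuous
   up to the endpoints, hence integrable. *)
move=> ab fI; have cf' := @smooth_fun_on_continuous _ _ _ 1%N fI.
have cf := @smooth_fun_on_continuous _ _ _ 0%N fI.
split.
  by apply: continuous_compact_integrable => //; exact: segment_compact.
rewrite EFinB; apply: continuous_FTC2 => //.
  split.
  - move=> t; rewrite in_itv /= => tab.
    have tI := nbhs_itvcc tab.
    have := derivable_on_is_derive tI (fI 0%N t (nbhs_singleton tI)).
    by case.
  - by have /continuous_within_itvP[] := cf.
  - by have /continuous_within_itvP[] := cf.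
move=> t; rewrite in_itv /= => tab; have tI := nbhs_itvcc tab.
have := derivable_on_is_derive tI (fI 0%N t (nbhs_singleton tI)).
by move=> ?; rewrite derive1E derive_val.
Qed.

Lemma itv_integral_cat a b c g u v : a <= b -> b <= c ->
  itv_integral a b g u -> itv_integral b c g v -> itv_integral a c g (u + v).
Proof.
move=> ab bc [gab abu] [gbc bcv].
have ac : `[a, c]%classic = `[a, b]%classic `|` `]b, c]%classic.
  by apply: itv_bndbnd_setU; rewrite bnd_simp.
have gbc' : mu.-integrable `]b, c] (EFin \o g).
  by apply: integrableS gbc => //; exact: subset_itv_oc_cc.
have dis : [disjoint `[a, b]%classic & `]b, c]%classic].
  apply/disj_setPS => t [] /=; rewrite !in_itv /= => /andP[_ tb] /andP[].
  by rewrite ltNge tb.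
have mg : measurable_fun (`[a, b] `|` `]b, c]) (EFin \o g).
  by apply/measurable_funU => //; split; [case/integrableP: gab|case/integrableP: gbc'].
split.
  rewrite ac; apply/integrableP; split => //.
  rewrite ge0_integral_setU//; last exact: measurableT_comp.
  by apply: lte_add_pinfty; [case/integrableP: gab|case/integrableP: gbc'].
rewrite ac integral_setU// abu EFinD -bcv; congr (_ + _)%E.
by apply: integral_itv_obnd_cbnd; case/integrableP: gbc'.
Qed.

Lemma itv_integral_point a g : itv_integral a a g 0.
Proof.
rewrite /itv_integral set_itv1; split; last exact: integral_set1.
apply/integrableP; split; first exact: measurable_fun_set1.
by rewrite integral_set1.
Qed.

Definition piecewise_smooth_fun a b f : Prop :=
  exists2 s : seq R, itv_partition a b s &
    forall k : nat, (k < size s)%N ->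
      smooth_fun_on `[nth b (a :: s) k, nth b (a :: s) k.+1] f.

Lemma path_lt_last (a : R) s : path <%R a s -> a <= last a s.
Proof.
elim: s a => //= c s IH a /andP[ac cs]; exact: le_trans (ltW ac) (IH _ cs).
Qed.

(** The derivative is taken relative to a fixed larger [[c, e]] while the induction peels pieces off
    [[a, b]] from the left. The increments telescope because adjacent closed pieces share the value
    of [f]. *)
Lemma itv_integral_piecewise a b c e f : c <= a -> b <= e ->
  piecewise_smooth_fun a b f ->
  itv_integral a b (derive_on `[c, e] f) (f b - f a).
Proof.
move=> ca be [s []]; elim: s a ca => [|a' s IH] a ca /=.
  by move=> _ /eqP -> _; rewrite subrr; exact: itv_integral_point.
move=> /andP[aa' a's] /eqP ls fI.
have a'b : a' <= b by rewrite -ls path_lt_last.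
rewrite -(subrKA (f a')) addrC.
apply: (@itv_integral_cat _ a'); rewrite ?(ltW aa')//.
  apply: itv_integral_eq_oo (itv_integral_derive_on aa' (fI 0%N isT)) => t taa'.
  by rewrite (derive_on_subitv _ ca _ taa')// (le_trans a'b be).
apply: IH => //; [exact: le_trans (ltW aa')|exact/eqP|].
by move=> k ks; exact: (fI k.+1 ks).
Qed.

End Increment.

(** * Linearity and comparison of integrals *)

Section IncrementLinear.
Context {R : realType}.
Local Notation mu := (@lebesgue_measure R).
Implicit Types (f g : R -> R) (a b t : R).

Lemma itv_integralD a b f g u v :
  itv_integral a b f u -> itv_integral a b g v ->
  itv_integral a b (fun t => f t + g t) (u + v).
Proof.
move=> [fi fu] [gi gv]; split.
  rewrite (_ : _ \o _ = (EFin \o f) \+ (EFin \o g))%E//.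
  exact: integrableD.
by rewrite EFinD -fu -gv -integralD.
Qed.

Lemma itv_integralZ a b f u c :
  itv_integral a b f u -> itv_integral a b (fun t => c * f t) (c * u).
Proof.
move=> [fi fu]; split.
  rewrite (_ : _ \o _ = (fun t => c%:E * (EFin \o f) t)%E)//.
  exact: integrableZl.
by rewrite EFinM -fu -integralZl.
Qed.

Lemma itv_integral_sum a b (I : Type) (s : seq I) (f : I -> R -> R) (u : I -> R) :
  (forall i, itv_integral a b (f i) (u i)) ->
  itv_integral a b (fun t => \sum_(i <- s) f i t) (\sum_(i <- s) u i).
Proof.
move=> fu; elim: s => [|i s IH].
  rewrite big_nil; split.
    rewrite (_ : _ \o _ = cst 0%E); first exact: integrable0.
    by apply/funext => t; rewrite /= big_nil.
  by under eq_integral do rewrite big_nil; rewrite integral0.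
rewrite big_cons (_ : (fun t => _) = (fun t => f i t + \sum_(j <- s) f j t)).
  exact: itv_integralD.
by apply/funext => t; rewrite big_cons.
Qed.

(* No measurability is needed, the integral of a nonnegative function being a
   supremum over simple functions. *)
Lemma le_integral_restrict (D E : set R) (f g : R -> \bar R) :
  (forall t, 0 <= (f \_ D) t)%E -> (forall t, (f \_ D) t <= (g \_ E) t)%E ->
  (\int[mu]_(t in D) f t <= \int[mu]_(t in E) g t)%E.
Proof.
move=> f0 fg; rewrite [leLHS]integral_mkcond [leRHS]integral_mkcond.
rewrite !ge0_integralTE//; last by move=> t; exact: le_trans (fg t).
apply: ereal_sup_le => _ [h hf <-]; exists h => // t.
exact: le_trans (hf t) (fg t).
Qed.

(** The set where [f] is nonzero lies in a null set, yet a positive value would by continuity put an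
    interval of positive length inside it. *)
Lemma continuous_integral0_eq0 a b f : a < b -> {within `[a, b], continuous f} ->
  (forall t, t \in `[a, b] -> 0 <= f t) -> itv_integral a b f 0 ->
  forall t, t \in `[a, b] -> f t = 0.
Proof.
move=> ab cf f0 [/integrableP[mf _] fint] t0 t0ab.
apply/eqP; rewrite eq_le f0// andbT leNgt; apply/negP => ft0.
have abs0 : (\int[mu]_(t in `[a, b]) `|(EFin \o f) t|)%E = 0%E.
  apply: etrans fint; apply: eq_integral => t /set_mem tab /=.
  by rewrite ger0_norm// f0.
have /ae_eq_integral_abs := mf.
move=> /(_ mu) h; have [+ _] := h (measurable_itv _).
move=> /(_ abs0) {h} [N [mN N0 subN]].
have : f t @[t --> within `[a, b] (nbhs t0)] --> f t0.
  by move/subspace_continuousP: cf; apply.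
move=> /cvgr_gt/(_ _ ft0).
rewrite near_withinE => -[e /= e0 eP].
(* Clipping the window around [t0] to [[a, b]] leaves a nondegenerate interval even when [t0] is an
   endpoint. *)
pose c := Num.max a (t0 - e); pose d := Num.min b (t0 + e).
move: t0ab; rewrite in_itv /= => /andP[at0 t0b].
have cd : c < d.
  rewrite /c /d lt_min !gt_max ab /= (le_lt_trans at0) ?ltrDl//=.
  by rewrite ltrBlDr (le_lt_trans t0b) ?ltrDl//= ltrBlDr -addrA ltrDl addr_gt0.
have : (mu `]c, d[%classic <= mu N)%E.
  apply: le_measure; rewrite ?inE//.
  move=> t /=; rewrite in_itv /= => /andP[].
  rewrite /c /d lt_min !gt_max => /andP[a_t et] /andP[t_b te].
  apply: subN => /=; rewrite in_itv /= !ltW//= => /(_ isT) [] ft.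
  have := eP t; rewrite /= ft ltxx in_itv /= !ltW//= => /(_ _ isT).
  by move=> h; suff : false by []; apply: h; rewrite ltr_distlC et te.
by rewrite N0 lebesgue_measure_itv /= lte_fin cd leNgt -EFinD lte_fin subr_gt0 cd.
Qed.

End IncrementLinear.

(** * Trace norm and length of curves *)

Section TraceNorm.
Context {R : realType}.
Local Notation C := R[i].

Lemma absmxE n (A : 'M[C]_n) : absmx A = abs_mx A.
Proof. by []. Qed.

Lemma trace_normE n (A : 'M[C]_n) : (trace_norm A)%:C = \tr (abs_mx A).
Proof. by rewrite /trace_norm absmxE RRe_real// ger0_real// trace_abs_ge0. Qed.

Lemma trace_norm_ge0 n (A : 'M[C]_n) : 0 <= trace_norm A.
Proof. by rewrite -ler0c trace_normE trace_abs_ge0. Qed.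

(** The real pairing: real-linear in [A], hence compatible with entrywise differentiation and
    integration. *)
Definition rtr n (U A : 'M[C]_n) : R := complex.Re (\tr (U *m A)).

Lemma rtr_le_trace_norm n (U A : 'M[C]_n) : A \is hermsymmx -> contraction_mx U ->
  rtr U A <= trace_norm A.
Proof.
move=> Ah Uc; rewrite -lecR trace_normE.
apply: le_trans (trace_abs_ge_contraction Ah Uc).
by apply: le_trans (normc_ge_Re _); rewrite lecR ler_norm.
Qed.

Lemma rtr_attained n (A : 'M[C]_n) : A \is hermsymmx ->
  exists2 U : 'M[C]_n, contraction_mx U & rtr U A = trace_norm A.
Proof.
move=> /trace_abs_attained[U Uc UA]; exists U => //.
by rewrite /rtr UA -trace_normE.
Qed.

Lemma ReD (x y : C) : complex.Re (x + y) = complex.Re x + complex.Re y.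
Proof. by case: x => ? ?; case: y. Qed.

Lemma ReM (x y : C) : complex.Re (x * y) =
  complex.Re x * complex.Re y - complex.Im x * complex.Im y.
Proof. by case: x => ? ?; case: y. Qed.

(** Expands the pairing in the real and imaginary parts of the entries, the functions that
    [velocity] differentiates. *)
Lemma rtrE n (U A : 'M[C]_n) : rtr U A = \sum_i \sum_j
  (complex.Re (U i j) * complex.Re (A j i)
   + - complex.Im (U i j) * complex.Im (A j i)).
Proof.
have Re_sum (F : 'I_n -> C) : complex.Re (\sum_i F i) = \sum_i complex.Re (F i).
  exact: (big_morph _ ReD).
rewrite /rtr /mxtrace Re_sum; apply: eq_bigr => i _.
by rewrite mxE Re_sum; apply: eq_bigr => j _; rewrite ReM mulNr.
Qed.

End TraceNorm.

(** * Velocities of matrix curves and lower bounds for the length *)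

Section Curves.
Context {R : realType}.
Local Notation C := R[i].
Local Notation mu := (@lebesgue_measure R).

(** Uniqueness of relative limits rests on this. A nearby point is found half a radius to the right,
    or to the left when [t] is the right endpoint. *)
Lemma itv_within_dnbhs_proper (a b t : R) : a < b -> t \in `[a, b] ->
  ProperFilter (within `[a, b] t^').
Proof.
move=> ab; rewrite in_itv /= => /andP[at_ tb].
apply: Build_ProperFilter => -[e /= e0 eP].
suff [s [se st sab]] : exists s, [/\ `|t - s| < e, s != t & s \in `[a, b]].
  exact: (eP s se st sab).
have e20 : 0 < e / 2 by rewrite divr_gt0.
have e2e : e / 2 < e by rewrite ltr_pdivrMr// ltr_pMr// ltr1n.
have [tb'|bt] := ltP t b.
  exists (Num.min b (t + e / 2)); split.
  - rewrite distrC ger0_norm ?subr_ge0 ?le_min ?tb ?lerDl ?(ltW e20)//.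
    by rewrite ltrBlDr gt_min [e + t]addrC ltrD2l e2e orbT.
  - by rewrite gt_eqF// lt_min tb' ltrDl.
  - by rewrite in_itv /= ge_min lexx le_min (le_trans at_ tb) ler_wpDr ?(ltW e20).
have -> : t = b by apply/le_anti; rewrite tb.
exists (Num.max a (b - e / 2)); split.
- rewrite ger0_norm ?subr_ge0 ?ge_max ?(ltW ab) ?lerBlDr ?lerDl ?(ltW e20)//.
  by rewrite ltrBlDr addrC -ltrBlDr lt_max ltrD2l ltrN2 e2e orbT.
- by rewrite lt_eqF// gt_max ab ltrBlDr ltrDl.
- by rewrite in_itv /= le_max lexx ge_max (ltW ab) lerBlDr lerDl (ltW e20).
Qed.

Lemma derive_onN (a b t : R) (f : R -> R) : a < b -> t \in `[a, b] ->
  derivable_on `[a, b] f t ->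
  derive_on `[a, b] (fun s => - f s) t = - derive_on `[a, b] f t.
Proof.
move=> ab tab ft; have FP := itv_within_dnbhs_proper ab tab.
rewrite /derive_on (_ : diff_quot (fun s => - f s) t = fun s => - diff_quot f t s).
  by apply: cvg_lim; [exact: Rhausdorff|exact: (cvgN ft)].
by apply/funext => s; rewrite /diff_quot -opprD mulrN.
Qed.

Lemma derive_on_linear (a b t c : R) (f : R -> R) : a < b -> t \in `[a, b] ->
  (forall s, f s = s * c) ->
  derivable_on `[a, b] f t /\ derive_on `[a, b] f t = c.
Proof.
move=> ab tab fc; have FP := itv_within_dnbhs_proper ab tab.
have h : diff_quot f t @ within `[a, b] t^' --> c.
  apply/cvgrPdist_lt => e e0; rewrite near_withinE; exists 1 => //= s _ st _.
  by rewrite /diff_quot !fc -mulrBl mulrA mulVf ?subr_eq0// mul1r subrr normr0.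
by split; [apply/cvg_ex; exists c|exact: cvg_lim].
Qed.

Lemma derive_on_cst (a b t c : R) (f : R -> R) : a < b -> t \in `[a, b] ->
  (forall s, s \in `[a, b] -> f s = c) ->
  derivable_on `[a, b] f t /\ derive_on `[a, b] f t = 0.
Proof.
move=> ab tab fc; have FP := itv_within_dnbhs_proper ab tab.
have h : diff_quot f t @ within `[a, b] t^' --> (0 : R).
  apply/cvgrPdist_lt => e e0; rewrite near_withinE; exists 1 => //= s _ st sab.
  by rewrite /diff_quot !fc// subrr mulr0 subrr normr0.
by split; [apply/cvg_ex; exists 0|exact: cvg_lim].
Qed.

Lemma smooth_fun_on_linear (a b c : R) : a < b ->
  smooth_fun_on `[a, b] (fun s => s * c).
Proof.
move=> ab [|k] t tab /=.
  by have [] := @derive_on_linear a b t c _ ab tab (fun=> erefl).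
(* The constant value on [[a, b]] of the derivative of order [k.+1]. *)
pose v := if k is 0 then c else 0.
have E : forall s, s \in `[a, b] ->
    derive_on `[a, b] (iter k (derive_on `[a, b]) (fun s => s * c)) s = v.
  rewrite /v; case: k {v}.
    by move=> s sab; have [] := @derive_on_linear a b s c _ ab sab (fun=> erefl).
  elim=> [|k IH] s sab.
    apply: (@derive_on_cst _ _ _ c _ ab sab _).2 => s' s'ab.
    by have [] := @derive_on_linear a b s' c _ ab s'ab (fun=> erefl).
  exact: (@derive_on_cst _ _ _ 0 _ ab sab IH).2.
exact: (@derive_on_cst _ _ _ v _ ab tab E).1.
Qed.

Lemma smooth_curve_piecewise n (X : R -> 'M[C]_n) :
  smooth_curve X -> piecewise_smooth_curve X.
Proof.
case=> Xh Xs; split => //; exists [:: 1].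
  by split; rewrite /= ?ltr01 ?eqxx.
by case.
Qed.

(** Agreement on the unit interval suffices because the derivative is relative to it. *)
Lemma velocity_block n (S : {set 'I_n}) (X : R -> 'M[C]_n) (Y : R -> 'M[C]_#|S|) t :
  t \in `[0, 1] -> (forall s, s \in `[0, 1] -> Y s = block S S (X s)) ->
  velocity Y t = block S S (velocity X t).
Proof.
move=> t01 YX; apply/matrixP => a b; rewrite !mxE.
by congr (_ +i* _); apply: derive_on_congr => // s s01; rewrite YX// mxE.
Qed.

(** Transposed entries have equal real parts and opposite imaginary parts. Derivability is asked of
    the latter since the default value of a limit need not commute with negation. *)
Lemma velocity_herm n (X : R -> 'M[C]_n) t : t \in `[0, 1] ->
  hermitian_valued X ->
  (forall i j, derivable_on `[0, 1] (fun s => complex.Im (X s i j)) t) ->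
  velocity X t \is hermsymmx.
Proof.
move=> t01 Xh Xd; apply/hermP/matrixP => i j; rewrite !mxE.
have XE s : s \in `[0, 1] -> X s j i = (X s i j)^*%C.
  by move=> /Xh/hermP => h; rewrite -{1}h !mxE.
rewrite -[LHS]/(_ -i* _); congr (_ +i* _).
  apply: derive_on_congr => // s s01; rewrite XE//; by case: (X s i j).
rewrite -derive_onN//; apply: derive_on_congr => // s s01; rewrite XE//.
by case: (X s i j) => ? ? /=; rewrite opprK.
Qed.

Lemma partition_piece (a b t : R) s : itv_partition a b s -> a <= t <= b ->
  t \notin a :: s ->
  exists2 k, (k < size s)%N & nth b (a :: s) k < t < nth b (a :: s) k.+1.
Proof.
case; elim: s a => [|c s IH] a /=.
  by move=> _ /eqP -> /le_anti ->; rewrite inE eqxx.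
move=> /andP[ac cs] ls /andP[at_ tb]; rewrite inE negb_or => /andP[ta ts].
have [tc|ct] := ltP t c.
  by exists 0%N => //=; rewrite tc andbT lt_neqAle eq_sym ta.
by have [|k ks kt] := IH c cs ls _ ts; [rewrite ct|exists k.+1].
Qed.

Lemma piecewise_sub (a b : R) s k : itv_partition a b s -> (k < size s)%N ->
  a <= nth b (a :: s) k /\ nth b (a :: s) k.+1 <= b.
Proof.
case; elim: s a k => // c s IH a [|k] /= /andP[ac cs] /[dup] ls /eqP le ks.
  by rewrite lexx -le path_lt_last.
by have [h ?] := IH c k cs ls ks; split => //; rewrite (le_trans (ltW ac)).
Qed.

(** At a break point the one-sided derivatives may differ, so the velocity there may hold default
    values; the list collects these exceptions. *)
Lemma piecewise_velocity_herm n (X : R -> 'M[C]_n) : piecewise_smooth_curve X ->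
  exists s : seq R, forall t, t \in `[0, 1] -> t \notin s ->
    velocity X t \is hermsymmx.
Proof.
case=> Xh [s s01 Xs]; exists (0 :: s) => t t01 ts.
apply: velocity_herm => // i j.
have [] := partition_piece s01 _ ts; first by rewrite in_itv in t01.
move=> k ks tk; have [sk0 sk1] := piecewise_sub s01 ks.
have tI := nbhs_itvcc tk.
have tJ : nbhs t `[0%R, 1%R]%classic.
  apply: filterS tI => u /=.
  by rewrite !in_itv /= => /andP[/(le_trans sk0) -> /le_trans ->].
have := (Xs k ks i j).2 0%N t (nbhs_singleton tI).
by rewrite /derivable_on !within_dnbhs.
Qed.

Lemma itv_integral_rtr_velocity n (U : 'M[C]_n) (X : R -> 'M[C]_n) :
  piecewise_smooth_curve X ->
  itv_integral 0 1 (fun t => rtr U (velocity X t)) (rtr U (X 1) - rtr U (X 0)).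
Proof.
case=> _ [s s01 Xs].
rewrite !rtrE -sumrB (_ : (fun t => _) = fun t => \sum_i \sum_j
  (complex.Re (U i j) * derive_on `[0, 1] (fun s => complex.Re (X s j i)) t
  + - complex.Im (U i j) * derive_on `[0, 1] (fun s => complex.Im (X s j i)) t)); last first.
  apply/funext => t; rewrite rtrE; apply: eq_bigr => i _; apply: eq_bigr => j _.
  by rewrite mxE.
apply: itv_integral_sum => i; rewrite -sumrB; apply: itv_integral_sum => j.
rewrite opprD addrACA -!mulrBr.
by apply: itv_integralD; apply: itv_integralZ; apply: itv_integral_piecewise => //;
  exists s => // k ks; have [] := Xs k ks j i.
Qed.

(** The finite set [B] is null and is removed from the integral of [phi]. Then [phi] is replaced by
    its positive part, since [le_integral_restrict] compares nonnegative functions. *)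
Lemma curve_length_ge n (X : R -> 'M[C]_n) (B : seq R) (phi : R -> R) v :
  itv_integral 0 1 phi v ->
  (forall t, t \in `[0, 1] -> t \notin B -> phi t <= trace_norm (velocity X t)) ->
  (v%:E <= curve_length X)%E.
Proof.
move=> [phii <-] phi_le.
have Bfin : finite_set [set` B] by exact: finite_seq.
have mB : measurable [set` B].
  by apply: countable_measurable => //; exact: finite_set_countable.
rewrite (@negligible_integral _ _ _ mu _ [set` B])//; last first.
  exact/countable_lebesgue_measure0/finite_set_countable.
apply: (@le_trans _ _
  (\int[mu]_(t in `[0%R, 1%R] `\` [set` B]) (Num.max (phi t) 0)%:E)%E).
  rewrite integralE -[leRHS]sube0; apply: leeB; last exact: integral_ge0.
  rewrite le_eqVlt; apply/orP; left; apply/eqP/eq_integral => t _.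
  by rewrite funeposE /= -EFin_max.
apply: le_integral_restrict => t; rewrite !patchE.
  by case: ifP => // _; rewrite lee_fin le_max lexx orbT.
case: ifPn => [/set_mem[t01 tB]|_]; last first.
  by case: ifP => _; rewrite ?lee_fin ?trace_norm_ge0.
rewrite mem_set// lee_fin ge_max trace_norm_ge0 andbT phi_le//.
by apply/negP => /tB.
Qed.

End Curves.

(** * Calibration of minimal curves by contractions *)

Section Calibration.
Context {R : realType}.
Local Notation C := R[i].
Local Notation mu := (@lebesgue_measure R).

Lemma smooth_velocity_herm n (X : R -> 'M[C]_n) t : smooth_curve X ->
  t \in `[0, 1] -> velocity X t \is hermsymmx.
Proof.
case=> Xh Xs t01; apply: velocity_herm => // i j.
exact: ((Xs i j).2 0%N t t01).
Qed.

Lemma cvg_sumr (I : Type) (s : seq I) (F : set_system R) (f : I -> R -> R)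
    (l : I -> R) : Filter F -> (forall i, f i @ F --> l i) ->
  (fun x => \sum_(i <- s) f i x) @ F --> \sum_(i <- s) l i.
Proof.
move=> FF fl; elim: s => [|i s IH].
  rewrite big_nil (_ : (fun x => _) = cst 0); first exact: cvg_cst.
  by apply/funext => x; rewrite big_nil.
rewrite big_cons (_ : (fun x => _) = fun x => f i x + \sum_(j <- s) f j x).
  exact: cvgD.
by apply/funext => x; rewrite big_cons.
Qed.

Lemma continuous_rtr_velocity n (U : 'M[C]_n) (X : R -> 'M[C]_n) :
  smooth_curve X ->
  {within `[0, 1], continuous (fun t => rtr U (velocity X t))}.
Proof.
case=> _ Xs; rewrite (_ : (fun t => _) = fun t => \sum_i \sum_j
  (complex.Re (U i j) * derive_on `[0, 1] (fun s => complex.Re (X s j i)) t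
  + - complex.Im (U i j) * derive_on `[0, 1] (fun s => complex.Im (X s j i)) t)); last first.
  apply/funext => t; rewrite rtrE; apply: eq_bigr => i _; apply: eq_bigr => j _.
  by rewrite mxE.
apply/subspace_continuousP => t t01.
apply: cvg_sumr => i; apply: cvg_sumr => j.
have [f1 f2] := Xs j i.
apply: cvgD; apply: cvgM; try exact: cvg_cst.
  exact: derivable_on_cvg (f1 1%N t t01).
exact: derivable_on_cvg (f2 1%N t t01).
Qed.

Lemma curve_length_ge_rtr n (U : 'M[C]_n) (X : R -> 'M[C]_n) :
  piecewise_smooth_curve X -> contraction_mx U ->
  ((rtr U (X 1) - rtr U (X 0))%:E <= curve_length X)%E.
Proof.
move=> Xp Uc; have [s sh] := piecewise_velocity_herm Xp.
apply: (@curve_length_ge _ _ _ s _ _ (itv_integral_rtr_velocity U Xp)) => t t01 ts.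
by apply: rtr_le_trace_norm => //; exact: sh.
Qed.

Lemma curve_length_rtr n (U : 'M[C]_n) (X : R -> 'M[C]_n) :
  piecewise_smooth_curve X ->
  (forall t, t \in `[0, 1] -> trace_norm (velocity X t) = rtr U (velocity X t)) ->
  curve_length X = (rtr U (X 1) - rtr U (X 0))%:E.
Proof.
move=> Xp XU; have [_ <-] := itv_integral_rtr_velocity U Xp.
by apply: eq_integral => t /set_mem t01; rewrite XU.
Qed.

(** The pairing with [U] bounds the length of every competitor below by a number depending only on
    the endpoints, and [X] attains it. *)
Lemma calibrated_minimal n (U : 'M[C]_n) (X : R -> 'M[C]_n) :
  piecewise_smooth_curve X -> contraction_mx U ->
  (forall t, t \in `[0, 1] -> trace_norm (velocity X t) = rtr U (velocity X t)) ->
  minimal_curve X.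
Proof.
move=> Xp Uc XU; split; first exact: Xp.
move=> Y Yp Y0 Y1.
rewrite (curve_length_rtr Xp XU).
rewrite -Y0 -Y1.
exact: curve_length_ge_rtr.
Qed.

(* If [U] fails to calibrate [X] at [t0], then the integrand can be bounded
   below by the maximum of the pairings with [U] and with a contraction
   attaining the norm at [t0]; this avoids the continuity of the norm. *)
Lemma minimal_calibrated n (U : 'M[C]_n) (X : R -> 'M[C]_n) :
  smooth_curve X -> contraction_mx U ->
  (curve_length X <= (rtr U (X 1) - rtr U (X 0))%:E)%E ->
  forall t, t \in `[0, 1] -> trace_norm (velocity X t) = rtr U (velocity X t).
Proof.
move=> Xs Uc XU t0 t01; have Xh t := @smooth_velocity_herm _ X t Xs.
have [W Wc Wt0] := rtr_attained (Xh t0 t01).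
pose g t := rtr U (velocity X t).
pose k t := rtr W (velocity X t) - g t.
pose h t := 2^-1 * (`|k t| + k t).
have h0 t : 0 <= h t.
  by rewrite mulr_ge0// -lerBlDr sub0r -normrN ler_norm.
have hle t : t \in `[0, 1] -> g t + h t <= trace_norm (velocity X t).
  move=> tI; rewrite /h; have [kt|kt] := leP 0 (k t).
    rewrite ger0_norm// mulrDr [_^-1 * _]mulrC -splitr.
    by rewrite /k addrC subrK; apply: rtr_le_trace_norm => //; exact: Xh.
  by rewrite ltr0_norm// addNr mulr0 addr0; apply: rtr_le_trace_norm => //; exact: Xh.
have ch : {within `[0, 1], continuous h}.
  have /subspace_continuousP gc := continuous_rtr_velocity (U := U) Xs.
  have /subspace_continuousP Wcont := continuous_rtr_velocity (U := W) Xs.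
  apply/subspace_continuousP => t tI; apply: cvgM; first exact: cvg_cst.
  have kc : k @ within `[0, 1] (nbhs t) --> k t.
    by apply: cvgB; [exact: Wcont|exact: gc].
  by apply: cvgD => //; apply: cvg_norm.
have [hi hv] : itv_integral 0 1 h (fine (\int[mu]_(t in `[0%R, 1%R]) (h t)%:E)%E).
  have hi : mu.-integrable `[0, 1] (EFin \o h).
    by apply: continuous_compact_integrable => //; exact: segment_compact.
  by split=> //; rewrite fineK//; exact: integrable_fin_num.
set w := fine _ in hv.
have w0 : w = 0.
  apply/le_anti; rewrite -!lee_fin -hv integral_ge0 ?andbT; last first.
    by move=> t _; rewrite lee_fin.
  rewrite hv lee_fin.
  have g_int := itv_integral_rtr_velocity U (smooth_curve_piecewise Xs).
  have gh := itv_integralD g_int (conj hi hv).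
  have := @curve_length_ge _ _ X [::] _ _ gh (fun t tI _ => hle t tI).
  by move=> /le_trans/(_ XU); rewrite lee_fin gerDl.
have h_int : itv_integral 0 1 h 0 by split=> //; rewrite hv w0.
have ht0 := continuous_integral0_eq0 ltr01 ch (fun t _ => h0 t) h_int t01.
apply/le_anti; rewrite rtr_le_trace_norm ?andbT//; last exact: Xh.
rewrite -Wt0 -subr_le0 -/(k t0).
move/eqP: ht0; rewrite mulf_eq0 invr_eq0 pnatr_eq0 /= addr_eq0 => /eqP kt0.
by rewrite -oppr_ge0 -kt0.
Qed.

Lemma derive_on0_cst (f : R -> R) : smooth_fun_on `[0, 1] f ->
  (forall t, t \in `[0, 1] -> derive_on `[0, 1] f t = 0) ->
  forall t, t \in `[0, 1] -> f t = f 0.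
Proof.
move=> fs f0 t; rewrite in_itv /= => /andP[]; rewrite le_eqVlt => /predU1P[<-//|t0 t1].
have cf := @smooth_fun_on_continuous _ _ _ 0%N fs.
have tI u : u \in `]0, t[ -> nbhs u `[0%R, 1%R]%classic.
  rewrite in_itv /= => /andP[u0 ut]; apply: nbhs_itvcc.
  by rewrite u0 (lt_le_trans ut).
have [||c ct] := @MVT R f (fun=> 0) 0 t t0.
- move=> u /tI uI; have uI' := nbhs_singleton uI.
  by rewrite -(f0 u uI'); apply: derivable_on_is_derive => //; exact: (fs 0%N).
- by apply: continuous_subspaceW cf; apply: subset_itvl; rewrite bnd_simp.
- by rewrite mul0r => /eqP; rewrite subr_eq0 => /eqP.
Qed.

End Calibration.

(** * Curves joining 0 to a diagonal matrix *)

Section SignedBlocks.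
Context {R : realType} {n : nat} (d : 'I_n -> R).
Local Notation C := R[i].
Local Notation S1 := (pos_idx d).
Local Notation S2 := (zero_idx d).
Local Notation S3 := (neg_idx d).
Local Notation E := (sign_mx S1 S3 : 'M[C]_n).

Lemma pos_neg_disjoint : {in S1, forall j, j \in S3 = false}.
Proof. by move=> j; rewrite !inE => /ltW; rewrite leNgt => /negbTE. Qed.

Lemma block_incl S (A : 'M[C]_n) :
  block S S A = (incl_mx S) ^t* *m A *m incl_mx S.
Proof.
apply/matrixP => a b; rewrite [LHS]mxE mxE (bigD1 (enum_val b))//= [X in _ + X]big1.
  rewrite addr0 mxE (bigD1 (enum_val a))//= [X in _ + X]big1.
    by rewrite addr0 incl_mx_adj [incl_mx _ _ _]mxE !eqxx mul1r mulr1.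
  by move=> j /negPf ja; rewrite incl_mx_adj ja mul0r.
by move=> j /negPf jb; rewrite [incl_mx _ _ _]mxE jb mulr0.
Qed.

Lemma block_eq0 (J K : {set 'I_n}) (A : 'M[C]_n) j k :
  block J K A = 0 -> j \in J -> k \in K -> A j k = 0.
Proof.
move=> A0 jJ kK; have /matrixP/(_ (enum_rank_in jJ j) (enum_rank_in kK k)) := A0.
by rewrite !mxE !enum_rankK_in.
Qed.

Lemma loewner_le0l m (A : 'M[C]_m) : loewner_le 0 A <-> posmx A.
Proof. by rewrite /loewner_le subr0. Qed.

Lemma loewner_le0r m (A : 'M[C]_m) : loewner_le A 0 <-> posmx (- A).
Proof. by rewrite /loewner_le sub0r. Qed.

Lemma trace_norm_sign_eq (A : 'M[C]_n) : A \is hermsymmx ->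
  trace_norm A = rtr E A -> abs_mx A = A *m E.
Proof.
move=> Ah AE; apply: trace_abs_eq_diag => //.
- exact: sign_row_real.
- exact/sign_row_le1/pos_neg_disjoint.
(* [rtr] keeps only a real part; the trace of a product of two Hermitian matrices is real, so
   nothing is lost. *)
- rewrite -trace_normE AE RRe_real//; apply: trace_mul_herm_real => //.
  by apply/hermP; apply: sign_mx_adj; exact: pos_neg_disjoint.
Qed.

Lemma trace_norm_real_diag : trace_norm (real_diag d) = rtr E (real_diag d).
Proof.
suff DE : abs_mx (real_diag d) = E *m real_diag d.
  by apply: complexI; rewrite trace_normE DE RRe_real// -DE ger0_real// trace_abs_ge0.
(* The matrix is already diagonal, so the identity is an eigenbasis. *)
have := @abs_mx_unitary_diag C n 1%:M (\row_j (d j)%:C).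
rewrite trmx1 map_mx1 !mul1mx !mulmx1 => ->; last 2 first.
- by apply/unitarymxP; rewrite trmx1 map_mx1 mulmx1.
- by move=> i; rewrite mxE complex_real.
apply/matrixP => j k; rewrite mul_sign_mx sign_rowE; last exact: pos_neg_disjoint.
case: (eqVneq j k) => [<-|/negPf jk]; last first.
  by rewrite !mxE jk !mulr0n mulr0.
rewrite !mxE eqxx !mulr1n !inE normc_def /= expr0n addr0 sqrtr_sqr.
case: ltrgt0P => dj; rewrite ?mul1r ?mulN1r ?mul0r ?rmorphN//.
Qed.


Lemma smooth_curve_block (S : {set 'I_n}) (X : R -> 'M[C]_n) : smooth_curve X ->
  smooth_curve (fun t => block S S (X t)).
Proof.
case=> Xh Xs; split.
  move=> t /Xh/hermP XtE; apply/hermP/matrixP => a b.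
  by rewrite -{2}XtE !mxE.
move=> a b; have [Xr Xi] := Xs (enum_val a) (enum_val b).
by split; [apply: smooth_fun_on_congr Xr|apply: smooth_fun_on_congr Xi] => s _;
  rewrite mxE.
Qed.

Definition segment (t : R) : 'M[C]_n := real_diag (fun j => t * d j).

Lemma segmentE t i j : segment t i j = (t * (d i *+ (i == j)))%:C.
Proof. by rewrite !mxE; case: eqP => [->|]; rewrite ?mulr1n// !mulr0n mulr0. Qed.

Lemma segment_smooth : smooth_curve segment.
Proof.
split=> [t _|i j].
  by apply/hermP; rewrite /segment adj_diag_mx// => i; rewrite mxE complex_real.
have h c := @smooth_fun_on_linear R 0 1 c ltr01.
split; [apply: smooth_fun_on_congr (h (d i *+ (i == j)))|
        apply: smooth_fun_on_congr (h 0)] => s _; rewrite segmentE//.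
by rewrite mulr0.
Qed.

Lemma segment_velocity t : t \in `[0, 1] -> velocity segment t = real_diag d.
Proof.
move=> t01; apply/matrixP => i j; rewrite [LHS]mxE.
rewrite (@derive_on_linear _ 0 1 t (d i *+ (i == j)) _ ltr01 t01 _).2; last first.
  by move=> s; rewrite segmentE.
rewrite (@derive_on_linear _ 0 1 t 0 _ ltr01 t01 _).2; last first.
  by move=> s; rewrite segmentE mulr0.
by rewrite !mxE; case: eqP => [->|_].
Qed.

Lemma segment0 : segment 0 = 0.
Proof. by apply/matrixP => i j; rewrite segmentE mul0r mxE. Qed.

Lemma segment1 : segment 1 = real_diag d.
Proof. by congr real_diag; apply/funext => j; rewrite mul1r. Qed.

Lemma rtr0 m (U : 'M[C]_m) : rtr U 0 = 0.
Proof. by rewrite /rtr mulmx0 mxtrace0. Qed.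

Lemma segment_length : curve_length segment = (rtr E (real_diag d))%:E.
Proof.
rewrite (@curve_length_rtr _ _ E) ?segment0 ?segment1 ?rtr0 ?subr0//.
  exact: smooth_curve_piecewise segment_smooth.
by move=> t t01; rewrite segment_velocity// trace_norm_real_diag.
Qed.

(** The straight segment is the one competitor: its length is the pairing of E with D, so minimality
    makes the lower bound for [X] an equality. *)
Lemma minimal_abs_velocity (X : R -> 'M[C]_n) : smooth_curve X ->
  minimal_curve_joining 0 (real_diag d) X ->
  forall t, t \in `[0, 1] -> abs_mx (velocity X t) = velocity X t *m E.
Proof.
move=> Xs [X0 X1 [_ Xmin]] t t01; apply: trace_norm_sign_eq.
  exact: smooth_velocity_herm.
apply: minimal_calibrated => //; first exact/sign_mx_contraction/pos_neg_disjoint.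
rewrite X0 X1 rtr0 subr0 -segment_length; apply: Xmin.
- exact: smooth_curve_piecewise segment_smooth.
- by rewrite segment0 X0.
- by rewrite segment1 X1.
Qed.

(** The identity calibrates [P]: the trace norm of a positive matrix is its trace. *)
Lemma minimal_of_velocity_ge0 m (P : R -> 'M[C]_m) : smooth_curve P ->
  (forall t, t \in `[0, 1] -> posmx (velocity P t)) -> minimal_curve P.
Proof.
move=> Ps Pp; apply: (@calibrated_minimal _ _ 1%:M).
- exact: smooth_curve_piecewise.
- exact: contraction_mx1.
- move=> t t01; rewrite /trace_norm absmxE abs_mx_id /rtr ?mul1mx//.
    exact: smooth_velocity_herm.
  exact: Pp.
Qed.

Lemma minimal_of_velocity_le0 m (N : R -> 'M[C]_m) : smooth_curve N ->
  (forall t, t \in `[0, 1] -> posmx (- velocity N t)) -> minimal_curve N.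
Proof.
move=> Ns Np; apply: (@calibrated_minimal _ _ (- 1%:M)).
- exact: smooth_curve_piecewise.
- exact/contraction_mxN/contraction_mx1.
- move=> t t01; rewrite /trace_norm absmxE abs_mx_opp /rtr ?mulNmx ?mul1mx//.
    exact: smooth_velocity_herm.
  exact: Np.
Qed.

Lemma velocity0_cst (X : R -> 'M[C]_n) i j : smooth_curve X ->
  (forall t, t \in `[0, 1] -> velocity X t i j = 0) ->
  forall t, t \in `[0, 1] -> X t i j = X 0 i j.
Proof.
move=> [_ Xs] X0 t t01; have [Xr Xi] := Xs i j.
have V u : u \in `[0, 1] ->
    derive_on `[0, 1] (fun s => complex.Re (X s i j)) u = 0 /\
    derive_on `[0, 1] (fun s => complex.Im (X s i j)) u = 0.
  by move=> /X0; rewrite mxE => -[].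
apply/eqP; rewrite eq_complex; apply/andP; split; apply/eqP.
  by apply: (derive_on0_cst Xr) => // u /V[].
by apply: (derive_on0_cst Xi) => // u /V[].
Qed.

Lemma velocity_eq0 (X : R -> 'M[C]_n) i j t : t \in `[0, 1] ->
  (forall t, t \in `[0, 1] -> X t i j = 0) -> velocity X t i j = 0.
Proof.
move=> t01 X0; rewrite mxE.
by congr (_ +i* _); apply: (@derive_on_cst _ _ _ _ 0 _ ltr01 t01 _).2 => s s01;
  rewrite X0.
Qed.

Lemma block3_diag_blocks (A : 'M[C]_n) :
  (forall j k, ~~ same_sign S1 S3 j k -> A j k = 0) ->
  block3 S1 S2 S3 A =
  block_mx (block S1 S1 A) 0 0 (block_mx 0 0 0 (block S3 S3 A)).
Proof.
move=> A0.
have B0 (J K : {set 'I_n}) :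
    (forall j k, j \in J -> k \in K -> ~~ same_sign S1 S3 j k) -> block J K A = 0.
  by move=> JK; apply/matrixP => a b; rewrite !mxE A0// JK// enum_valP.
(* In terms of the signs of [d], trichotomy at [j] and [k] decides each of the seven vanishing
   blocks. *)
have off j k : ~~ same_sign S1 S3 j k =
    ~~ ((0 < d j) && (0 < d k) || (d j < 0) && (d k < 0)) by rewrite /same_sign !inE.
have [] : block S1 S2 A = 0 /\ block S1 S3 A = 0.
  by split; apply: B0 => j k; rewrite off !inE;
    case: (ltrgt0P (d j)); case: (ltrgt0P (d k)).
have [] : block S2 S1 A = 0 /\ block S3 S1 A = 0.
  by split; apply: B0 => j k; rewrite off !inE;
    case: (ltrgt0P (d j)); case: (ltrgt0P (d k)).
have [] : block S2 S2 A = 0 /\ block S2 S3 A = 0.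
  by split; apply: B0 => j k; rewrite off !inE;
    case: (ltrgt0P (d j)); case: (ltrgt0P (d k)).
have S32 : block S3 S2 A = 0.
  by apply: B0 => j k; rewrite off !inE; case: (ltrgt0P (d j)); case: (ltrgt0P (d k)).
by rewrite /block3 S32 => -> -> -> -> -> ->; rewrite row_mx0 col_mx0.
Qed.

Lemma block3_diag_blocksP (A : 'M[C]_n) (P : 'M[C]_#|S1|) (N : 'M[C]_#|S3|) :
  block3 S1 S2 S3 A = block_mx P 0 0 (block_mx 0 0 0 N) ->
  [/\ P = block S1 S1 A, N = block S3 S3 A &
      forall j k, ~~ same_sign S1 S3 j k -> A j k = 0].
Proof.
rewrite /block3 => /eq_block_mx[-> + + /eq_block_mx[A22 A23 A32 ->]].
rewrite -[0 in X in X -> _]row_mx0 => /eq_row_mx[A12 A13].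
rewrite -[0 in X in X -> _]col_mx0 => /eq_col_mx[A21 A31].
split=> // j k; rewrite /same_sign !inE.
case: (ltrgt0P (d j)) => dj; case: (ltrgt0P (d k)) => dk //= _.
- by apply: (block_eq0 A13); rewrite inE.
- by apply: (block_eq0 A12); rewrite inE ?dk.
- by apply: (block_eq0 A31); rewrite inE.
- by apply: (block_eq0 A32); rewrite inE ?dk.
- by apply: (block_eq0 A21); rewrite inE ?dj.
- by apply: (block_eq0 A23); rewrite inE ?dj.
- by apply: (block_eq0 A22); rewrite inE ?dj ?dk.
Qed.

End SignedBlocks.

Theorem theorem4p7 (R : realType) (n : nat) (d : 'I_n -> R)
    (X : R -> 'M[R[i]]_n)
    (d_decr : forall i j : 'I_n, (i <= j)%N -> d j <= d i)
    (X_smooth : smooth_curve X)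
    (X0 : X 0 = 0)
    (X1 : X 1 = real_diag d) :
  let D := real_diag d in
  let S1 := pos_idx d in
  let S2 := zero_idx d in
  let S3 := neg_idx d in
  minimal_curve_joining 0 D X <->
  exists (P : R -> 'M[R[i]]_#|S1|) (N : R -> 'M[R[i]]_#|S3|),
    [/\ smooth_curve P /\ smooth_curve N,
        minimal_curve_joining 0 (block S1 S1 D) P /\
          (forall t : R, t \in `[0, 1] -> loewner_le 0 (velocity P t)),
        minimal_curve_joining 0 (block S3 S3 D) N /\
          (forall t : R, t \in `[0, 1] -> loewner_le (velocity N t) 0) &
        forall t : R, t \in `[0, 1] ->
          block3 S1 S2 S3 (X t) =
            block_mx (P t) 0
                     0     (block_mx 0 0
                                     0 (N t))].
Proof.
move=> D S1 S2 S3.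
have S13 : {in S1, forall j, j \in S3 = false} by exact: pos_neg_disjoint.
have Vh t := @smooth_velocity_herm _ _ X t X_smooth.
have V1 t (t01 : t \in `[0, 1]) :=
  @velocity_block _ _ S1 X (fun t => block S1 S1 (X t)) t t01 (fun _ _ => erefl).
have V3 t (t01 : t \in `[0, 1]) :=
  @velocity_block _ _ S3 X (fun t => block S3 S3 (X t)) t t01 (fun _ _ => erefl).
have block0 S : block S S (0 : 'M[R[i]]_n) = 0.
  by apply/matrixP => a b; rewrite !mxE.
split=> [Xmin|[P [N [[Ps Ns] [_ Pv] [_ Nv] XPN]]]].
  have absV := minimal_abs_velocity X_smooth Xmin.
  have Pv t : t \in `[0, 1] -> posmx (velocity (fun t => block S1 S1 (X t)) t).
    by move=> t01; rewrite V1// block_incl; exact: (abs_sign_pos S13 (absV t t01)).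
  have Nv t : t \in `[0, 1] -> posmx (- velocity (fun t => block S3 S3 (X t)) t).
    by move=> t01; rewrite V3// block_incl; exact: (abs_sign_neg S13 (absV t t01)).
  have Ps := smooth_curve_block S1 X_smooth.
  have Ns := smooth_curve_block S3 X_smooth.
  (* The witnesses are the compressions of [X], whose velocities are the compressions of its
     velocity. *)
  exists (fun t => block S1 S1 (X t)), (fun t => block S3 S3 (X t)).
  split; first by split.
  - split; last by move=> t t01; apply/loewner_le0l; exact: Pv.
    by split; [rewrite X0 block0|rewrite X1|exact: minimal_of_velocity_ge0].
  - split; last by move=> t t01; apply/loewner_le0r; exact: Nv.
    by split; [rewrite X0 block0|rewrite X1|exact: minimal_of_velocity_le0].
  - move=> t t01; apply: block3_diag_blocks => j k jk.
    (* An entry off the two blocks has zero velocity, so it keeps its initial value 0. *)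
    rewrite (velocity0_cst X_smooth _ t01) ?X0 ?mxE// => u u01.
    exact: (abs_sign_eq0 S13 (Vh u u01) (absV u u01) jk).
have XE t (t01 : t \in `[0, 1]) := block3_diag_blocksP (XPN t t01).
(* E calibrates [X] once |X'| = E X' at every time. The block form of [X] passes to its velocity,
   and the signs of the blocks are those of the velocities of [P] and [N]. *)
split; [exact: X0|exact: X1|apply: (@calibrated_minimal _ _ (sign_mx S1 S3))].
- exact: smooth_curve_piecewise.
- exact: sign_mx_contraction.
move=> t t01; rewrite /trace_norm absmxE (@abs_sign_blocks _ _ S1 S3)//.
- exact: Vh.
- move=> j k jk; apply: velocity_eq0 => // u /XE[_ _ X_off]; exact: X_off.
- rewrite -block_incl -(@velocity_block _ _ S1 X P t t01).
    by apply/loewner_le0l; exact: Pv.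
  by move=> s /XE[-> _].
- rewrite -block_incl -(@velocity_block _ _ S3 X N t t01).
    by apply/loewner_le0r; exact: Nv.
  by move=> s /XE[_ ->].
Qed.
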